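(* Let $G$ be a finite non-abelian group with center $Z(G)$. Then: (1) if $G/Z(G)\cong\mathbb{Z}_p\times\mathbb{Z}_p$ for a prime $p$, or $G\cong U_{6m}$ ($m\ge2$), then $\Gamma_G$ is integral, L-integral and Q-integral; (2) if $G\cong D_{2m}$ ($m\ge3$), $T_{4m}$ ($m\ge2$), $SD_{8m}$ ($m\ge2$), $U_{(n,m)}$ ($m\ge3,n\ge2$) or $V_{8m}$ ($m\ge2$), then $\Gamma_G$ is L-integral; more generally, if $G/Z(G)\cong D_{2m}$ for some $m\ge3$, then $\Gamma_G$ is L-integral; (3) if $G\cong D_{2m}$, $T_{4m}$, $SD_{8m}$ or $U_{(n,m)}$ ($n\ge2$) with $m\ge3$ odd, then $\Gamma_G$ is Q-integral; (4) if $G\cong D_{2m}$ or $U_{(n,m)}$ ($n\ge2$) with $m$ even and $m/2$ odd, then $\Gamma_G$ is Q-integral.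
   Context: Groups: $D_{2m}=\langle x,y\mid x^m=y^2=1,\ yxy^{-1}=x^{-1}\rangle$; $T_{4m}=\langle x,y\mid x^{2m}=1,\ x^m=y^2,\ y^{-1}xy=x^{-1}\rangle$; $SD_{8m}=\langle x,y\mid x^{4m}=y^2=1,\ yxy=x^{2m-1}\rangle$; $U_{(n,m)}=\langle x,y\mid x^{2n}=y^m=1,\ x^{-1}yx=y^{-1}\rangle$; $U_{6m}=\langle x,y\mid x^{2m}=y^3=1,\ x^{-1}yx=y^{-1}\rangle$; $V_{8m}=\langle x,y\mid x^{2m}=y^4=1,\ yx=x^{-1}y^{-1},\ y^{-1}x=x^{-1}y\rangle$. The NCCC-graph $\Gamma_G$ of a finite non-abelian group $G$ has vertex set $\{x^G: x\in G\setminus Z(G)\}$ ($x^G$ the conjugacy class of $x$), distinct vertices $x^G,y^G$ adjacent iff $x'y'\neq y'x'$ for all $x'\in x^G,y'\in y^G$. With $A$ the adjacency matrix and $D$ the degree matrix, a graph is integral (resp. L-integral, Q-integral) if all eigenvalues of $A$ (resp. $L=D-A$, $Q=D+A$) are integers. *)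

(* Defs.v *)
From HB Require Import structures.
From mathcomp Require Import all_boot all_order all_algebra all_fingroup all_solvable all_field.
Set Implicit Arguments.
Unset Strict Implicit.
Unset Printing Implicit Defensive.
Import GRing.Theory Num.Theory.

Section NCCC.
Variable gT : finGroupType.
Variable G : {group gT}.

Local Open Scope group_scope.

Definition nccc_vertices : {set {set gT}} :=
  [set x ^: G | x in G :\: 'Z(G)].

Definition nccc_adj (C D : {set gT}) : bool :=
  (C != D) && [forall x in C, forall y in D, x * y != y * x].

Definition nccc_n := #|nccc_vertices|.

Definition nccc_vert (i : 'I_nccc_n) : {set gT} := enum_val i.

Local Open Scope ring_scope.

Definition nccc_A : 'M[algC]_nccc_n :=
  \matrix_(i, j) (nccc_adj (nccc_vert i) (nccc_vert j))%:R.

Definition nccc_deg (C : {set gT}) : nat :=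
  #|[set D in nccc_vertices | nccc_adj C D]|.

Definition nccc_D : 'M[algC]_nccc_n :=
  diag_mx (\row_i (nccc_deg (nccc_vert i))%:R).

Definition nccc_L : 'M[algC]_nccc_n := nccc_D - nccc_A.
Definition nccc_Q : 'M[algC]_nccc_n := nccc_D + nccc_A.

End NCCC.

Definition integral_spectrum (n : nat) (M : 'M[algC]_n) : Prop :=
  forall a : algC, eigenvalue M a -> a \in Num.int.

Definition nccc_integral (gT : finGroupType) (G : {group gT}) : Prop :=
  integral_spectrum (nccc_A G).
Definition nccc_L_integral (gT : finGroupType) (G : {group gT}) : Prop :=
  integral_spectrum (nccc_L G).
Definition nccc_Q_integral (gT : finGroupType) (G : {group gT}) : Prop :=
  integral_spectrum (nccc_Q G).

Section Presentations.
Local Open Scope group_scope.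
Variable gT : finGroupType.
Implicit Type G : {set gT}.

Definition iso_D G (m : nat) : Prop :=
  G \isog Grp (x : y : (x ^+ m, y ^+ 2, y * x * y^-1 = x^-1)).
Definition iso_T G (m : nat) : Prop :=
  G \isog Grp (x : y : (x ^+ (2 * m)%N, x ^+ m = y ^+ 2, y^-1 * x * y = x^-1)).
Definition iso_SD G (m : nat) : Prop :=
  G \isog Grp (x : y : (x ^+ (4 * m)%N, y ^+ 2, y * x * y = x ^+ (2 * m - 1)%N)).
Definition iso_U G (n m : nat) : Prop :=
  G \isog Grp (x : y : (x ^+ (2 * n)%N, y ^+ m, x^-1 * y * x = y^-1)).
Definition iso_U6 G (m : nat) : Prop :=
  G \isog Grp (x : y : (x ^+ (2 * m)%N, y ^+ 3, x^-1 * y * x = y^-1)).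
Definition iso_V G (m : nat) : Prop :=
  G \isog Grp (x : y : (x ^+ (2 * m)%N, y ^+ 4, y * x = x^-1 * y^-1,
                        y^-1 * x = x^-1 * y)).
End Presentations.

(* Main.v *)
Require Import Defs.
From HB Require Import structures.
From mathcomp Require Import all_boot all_order all_algebra all_fingroup all_solvable all_field.

Local Open Scope group_scope.

(** For the groups considered, centralizers of noncentral elements are abelian,
so commuting is transitive on noncentral elements, and so is non-adjacency in
the NCCC-graph: the graph is complete multipartite, hence L-integral.  Abelian
centralizers come from a central quotient of order p^2, or from an abelian
subgroup A of index 2.  For index 2, the classes inside A form one part, and
the graph is complete bipartite as soon as A = [A, y] Z(G) for some y outside
A; the signless Laplacian is then conjugate to the Laplacian by a diagonal
sign matrix.  If #|G : Z(G)| = p^2, or in the case of U_{6m}, all parts have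
the same size and the adjacency matrix has integral spectrum too. *)

(** * Spectra of complete multipartite graphs *)

Section CompleteMultipartite.
Set Implicit Arguments.
Unset Strict Implicit.
Import GRing.Theory Num.Theory.
Local Open Scope ring_scope.

Variables (n : nat) (e : rel 'I_n).
Hypothesis eqe : equivalence_rel e.

(** The graph is encoded by non-adjacency [e], whose equivalence classes are the parts; reflexivity
    of [e] rules out loops. *)
Definition part_adj_mx : 'M[algC]_n := \matrix_(i, j) (~~ e i j)%:R.
Definition part_deg_mx : 'M[algC]_n :=
  diag_mx (\row_i #|[set j | ~~ e i j]|%:R).

Let part i : {set 'I_n} := [set j | e i j].

Local Lemma e_refl i : e i i. Proof. by case: (eqe i i i). Qed.

Local Lemma e_trans i j : e i j -> e i =1 e j.
Proof. by move=> eij k; case: (eqe i j k) => _ ->. Qed.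

Local Lemma e_sym i j : e i j = e j i.
Proof. by apply/idP/idP => h; rewrite -(e_trans h) e_refl. Qed.

Local Lemma part_eq i j : e i j -> part i = part j.
Proof. by move=> eij; apply/setP=> k; rewrite !inE (e_trans eij). Qed.

Local Lemma deg_part i : #|[set j | ~~ e i j]|%:R = n%:R - #|part i|%:R :> algC.
Proof.
have -> : [set j | ~~ e i j] = ~: part i by apply/setP=> j; rewrite !inE.
by rewrite -[X in X%:R - _](card_ord n) -(cardsC (part i)) natrD addrC addKr.
Qed.

Let psum (u : 'rV[algC]_n) i := \sum_(j | e i j) u 0 j.

Local Lemma psum_eq u i j : e i j -> psum u i = psum u j.
Proof. by move=> eij; apply: eq_bigl => k; exact: e_trans. Qed.

Local Lemma sum_part (x : algC) i : \sum_(j | e i j) x = #|part i|%:R * x.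
Proof.
rewrite big_const iter_addr addr0 mulr_natl; congr (_ *+ _).
by apply: eq_card => j; rewrite !inE.
Qed.

Local Lemma sum_psum u : \sum_j psum u j = \sum_j #|part j|%:R * u 0 j.
Proof.
rewrite /psum (exchange_big_dep predT) //=; apply: eq_bigr => j _.
by rewrite -sum_part; apply: eq_bigl => i; rewrite e_sym.
Qed.

Local Lemma adj_mxE u j : (u *m part_adj_mx) 0 j = \sum_k u 0 k - psum u j.
Proof.
rewrite mxE (bigID (e j)) /= [in RHS](bigID (e j)) /= -/(psum u j).
rewrite [RHS]addrC addKr big1 ?add0r => [|i eji].
  by apply: eq_bigr => i nji; rewrite mxE e_sym nji mulr1.
by rewrite mxE e_sym eji mulr0.
Qed.

Local Lemma deg_mxE (u : 'rV[algC]_n) j : (u *m part_deg_mx) 0 j = (n%:R - #|part j|%:R) * u 0 j.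
Proof. by rewrite mul_mx_diag !mxE deg_part mulrC. Qed.

(** Once all part sums vanish, the matrix acts on [u] coordinatewise by the scalars [c j], so any
    nonzero coordinate identifies the eigenvalue. *)
Local Lemma psum0_eigenvalue u a (c : 'I_n -> algC) :
  (forall j, psum u j = 0) -> u != 0 -> (forall j, psum u j = 0 -> c j * u 0 j = a * u 0 j) ->
  exists j, a = c j.
Proof.
move=> S0 /rV0Pn[j uj] h; exists j.
by apply: (mulIf uj); rewrite h.
Qed.

(** Summing the eigenvector equation over all vertices gives [a * s = 0]; if [s = 0], summing it
    over a part gives [(n - a) * psum u j = 0]. So [a] is 0, [n], or [n] minus the size of a
    part. *)
Lemma multipartite_L_integral : integral_spectrum (part_deg_mx - part_adj_mx).
Proof.
move=> a /eigenvalueP[u /rowP ua u0].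
pose s := \sum_k u 0 k.
have eq_a j : (n%:R - #|part j|%:R) * u 0 j - (s - psum u j) = a * u 0 j.
  have := ua j; rewrite mulmxBr mxE [(- _ : matrix _ _ _) _ _]mxE adj_mxE deg_mxE.
  by rewrite [in RHS]mxE.
have s0 : a * s = 0.
  rewrite mulr_sumr -(eq_bigr _ (fun j _ => eq_a j)) !sumrB sumr_const card_ord sum_psum.
  under eq_bigr do rewrite mulrBl.
  by rewrite sumrB -mulr_sumr -/s mulr_natl subrr.
have [->|a0] := eqVneq a 0; first exact: rpred0.
have {}s0 : s = 0 by apply/eqP; move/eqP: s0; rewrite mulf_eq0 (negPf a0).
have eqS j : (n%:R - a) * psum u j = 0.
  apply/eqP; rewrite mulrBl subr_eq0; apply/eqP.
  rewrite [a * _]mulr_sumr (eq_bigr (fun k => (n%:R - #|part j|%:R) * u 0 k + psum u j)); last first.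
    by move=> k ejk; rewrite -eq_a s0 sub0r opprK (part_eq ejk) (psum_eq _ ejk).
  by rewrite big_split /= -mulr_sumr sum_part -mulrDl subrK.
have [->|aN] := eqVneq a n%:R; first exact: rpred_nat.
have S0 j : psum u j = 0.
  by apply/eqP; move/eqP: (eqS j); rewrite mulf_eq0 subr_eq0 eq_sym (negPf aN).
have [|j ->] := @psum0_eigenvalue u a (fun j => n%:R - #|part j|%:R) S0 u0.
  by move=> j Sj; rewrite -eq_a s0 Sj !subr0.
by rewrite rpredB ?rpred_nat.
Qed.

Section EqualParts.
Variable q : nat.
Hypothesis card_part : forall i, #|[set j | e i j]| = q.

(** The same two summations, over all vertices and then over a part, leave only [n - q], [- q] and
    0. *)
Lemma regular_multipartite_integral : integral_spectrum part_adj_mx.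
Proof.
move=> a /eigenvalueP[u /rowP ua u0].
pose s := \sum_k u 0 k.
have eq_a j : s - psum u j = a * u 0 j.
  by have := ua j; rewrite adj_mxE [in RHS]mxE.
have hs : (n%:R - q%:R - a) * s = 0.
  rewrite mulrBl [a * s]mulr_sumr -(eq_bigr _ (fun j _ => eq_a j)) sumrB sumr_const.
  rewrite card_ord sum_psum; under [X in _ - (_ - X)]eq_bigr do rewrite /part card_part.
  by rewrite -mulr_sumr mulrBl !mulr_natl subrr.
have [aN|aN] := eqVneq (n%:R - q%:R - a) 0.
  by move/eqP: aN; rewrite subr_eq0 => /eqP <-; rewrite rpredB ?rpred_nat.
have s0 : s = 0 by apply/eqP; move/eqP: hs; rewrite mulf_eq0 (negPf aN).
have eqS j : (a + q%:R) * psum u j = 0.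
  apply/eqP; rewrite mulrDl addr_eq0 [a * _]mulr_sumr; apply/eqP.
  rewrite (eq_bigr (fun k => - psum u j)) ?sum_part ?/part ?card_part ?mulrN //.
  by move=> k ejk; rewrite -eq_a s0 sub0r (psum_eq _ ejk).
have [aq|aq] := eqVneq (a + q%:R) 0.
  by move/eqP: aq; rewrite addr_eq0 => /eqP->; rewrite rpredN rpred_nat.
have S0 j : psum u j = 0 by apply/eqP; move/eqP: (eqS j); rewrite mulf_eq0 (negPf aq).
have [|j ->] := @psum0_eigenvalue u a (fun=> 0) S0 u0; last exact: rpred0.
by move=> j Sj; rewrite -eq_a s0 Sj subr0 mul0r.
Qed.

(** Equal parts make the graph regular, so the degree matrix is scalar and merely shifts the
    adjacency spectrum by [n - q]. *)
Lemma regular_multipartite_Q_integral :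
  integral_spectrum (part_deg_mx + part_adj_mx).
Proof.
have -> : part_deg_mx = (n%:R - q%:R)%:M.
  apply/matrixP=> i j; by rewrite !mxE deg_part /part card_part.
move=> a /eigenvalueP[u ua u0].
rewrite -[a](subrK (n%:R - q%:R)) rpredD //; last by rewrite rpredB ?rpred_nat.
apply: regular_multipartite_integral; apply/eigenvalueP; exists u => //.
by rewrite scalerBl -ua mulmxDr mul_mx_scalar addrC addKr.
Qed.

End EqualParts.

(* Flipping the sign of the entries on one side turns D + A into D - A. *)
Lemma bipartite_Q_integral (f : pred 'I_n) :
  (forall i j, e i j = (f i == f j)) ->
  integral_spectrum (part_deg_mx + part_adj_mx).
Proof.
move=> ef a /eigenvalueP[u /rowP ua u0].
pose v : 'rV[algC]_n := \row_j ((-1) ^+ f j * u 0 j).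
apply: multipartite_L_integral; apply/eigenvalueP; exists v; last first.
  by have /rV0Pn[j uj] := u0; apply/rV0Pn; exists j; rewrite mxE mulf_neq0 ?signr_eq0.
apply/rowP=> j; have := ua j; rewrite mulmxDr mulmxBr !mul_mx_diag !mxE => uaj.
rewrite mulrCA -uaj mulrDr mulrA; congr (_ + _).
rewrite mulr_sumr -sumrN; apply: eq_bigr => i _; rewrite !mxE ef.
by case: (f i); case: (f j); rewrite /= ?(mulr0, mulr1, oppr0, mul1r, mulN1r, opprK, expr1).
Qed.

End CompleteMultipartite.

(** * Non-adjacency of conjugacy classes *)

Section NonAdjacency.
Set Implicit Arguments.
Unset Strict Implicit.

Variables (gT : finGroupType) (G : {group gT}).
Implicit Types (x y : gT) (C D S : {set gT}).

(** Simultaneous conjugation moves a commuting pair so that its first member is [x]; equal classes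
    are covered because some conjugate of [y] is [x] itself. *)
Lemma nccc_nadjP x y : x \in G -> y \in G ->
  reflect (exists2 g, g \in G & commute x (y ^ g)) (~~ nccc_adj (x ^: G) (y ^: G)).
Proof.
move=> Gx Gy; rewrite /nccc_adj negb_and negbK.
apply: (iffP orP) => [[/eqP/esym/class_eqP/imsetP[g Gg ->]|] | [g Gg cxy]].
- by exists g^-1; rewrite ?groupV // conjgK.
- case/forall_inPn=> _ /imsetP[g Gg ->] /forall_inPn[_ /imsetP[h Gh ->]].
  rewrite negbK => /eqP cxy; exists (h * g^-1); first by rewrite groupM ?groupV.
  by rewrite conjgM -[x](conjgK g); apply/esym; rewrite /commute -!conjMg cxy.
right; apply/forall_inPn; exists x; first exact: class_refl.
by apply/forall_inPn; exists (y ^ g); [apply: imset_f | rewrite negbK; apply/eqP].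
Qed.

Lemma nccc_vertP (i : 'I_(nccc_n G)) :
  exists2 x, x \in G :\: 'Z(G) & nccc_vert i = x ^: G.
Proof. by have /imsetP[x Zx ix] := enum_valP i; exists x. Qed.

Lemma card_nccc_vert (P : pred {set gT}) :
  #|[set i : 'I_(nccc_n G) | P (nccc_vert i)]| = #|[set C in nccc_vertices G | P C]|.
Proof.
rewrite -(card_imset _ enum_val_inj); apply: eq_card => C; rewrite [in RHS]inE.
apply/imsetP/andP=> [[i Pi ->] | [VC PC]].
  by split; [exact: enum_valP | rewrite inE in Pi].
exists (enum_rank_in VC C); last by rewrite enum_rankK_in.
by rewrite inE /nccc_vert enum_rankK_in.
Qed.

Definition nccc_nadj : rel 'I_(nccc_n G) :=
  fun i j => ~~ nccc_adj (nccc_vert i) (nccc_vert j).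

Lemma nccc_A_part : nccc_A G = part_adj_mx nccc_nadj.
Proof. by apply/matrixP=> i j; rewrite !mxE negbK. Qed.

Lemma nccc_D_part : nccc_D G = part_deg_mx nccc_nadj.
Proof.
congr diag_mx; apply/rowP=> i; rewrite !mxE /nccc_deg -card_nccc_vert.
by congr (_%:R)%R; apply: eq_card => j; rewrite !inE negbK.
Qed.

Lemma card_classes_uniform S c :
  G \subset 'N(S) -> {in S, forall y, #|y ^: G| = c} ->
  (#|[set y ^: G | y in S]| * c = #|S|)%N.
Proof.
move=> nSG cS; apply/esym; apply: card_uniform_partition; last first.
  by apply: (@orbit_partition _ _ _ 'J); rewrite astabsJ.
by move=> _ /imsetP[y Sy ->]; exact: cS.
Qed.

Lemma commute_conj_in (x y g : gT) : commute x y -> commute (x ^ g) (y ^ g).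
Proof. by rewrite /commute -!conjMg => ->. Qed.

Lemma noncentralJ (x g : gT) :
  g \in G -> (x ^ g \in G :\: 'Z(G)) = (x \in G :\: 'Z(G)).
Proof.
move=> Gg; rewrite memJ_norm //; apply: subsetP Gg.
by rewrite normsD ?normG ?normal_norm ?center_normal.
Qed.

Section AbelianCentralizers.
Hypothesis abelC : {in G :\: 'Z(G), forall x, abelian 'C_G[x]}.

(** Both [x] and [z] lie in the abelian centralizer of the noncentral [y]. *)
Lemma noncentral_commute_trans x y z :
  y \in G :\: 'Z(G) -> x \in G -> z \in G ->
  commute x y -> commute y z -> commute x z.
Proof.
move=> Zy Gx Gz cxy cyz; apply: (centsP (abelC Zy)).
  by apply/subcent1P; split=> //; exact: commute_sym.
by apply/subcent1P.
Qed.

Lemma nccc_nadj_equiv : equivalence_rel nccc_nadj.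
Proof.
apply/equivalence_relP; split=> [i | i j ij k].
  by rewrite /nccc_nadj /nccc_adj eqxx.
have sym k1 k2 : nccc_nadj k1 k2 -> nccc_nadj k2 k1.
  rewrite /nccc_nadj; have [x /setDP[Gx _] ->] := nccc_vertP k1.
  have [y /setDP[Gy _] ->] := nccc_vertP k2.
  case/nccc_nadjP=> // g Gg cxy; apply/nccc_nadjP=> //.
  exists g^-1; rewrite ?groupV // -[y](conjgK g).
  by apply: commute_conj_in; exact: commute_sym.
have trans k1 k2 k3 : nccc_nadj k1 k2 -> nccc_nadj k2 k3 -> nccc_nadj k1 k3.
  rewrite /nccc_nadj; have [x /setDP[Gx _] ->] := nccc_vertP k1.
  have [y Zy ->] := nccc_vertP k2; have [z /setDP[Gz _] ->] := nccc_vertP k3.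
  have /setDP[Gy _] := Zy.
  case/nccc_nadjP=> // g Gg cxy /nccc_nadjP[] // h Gh cyz; apply/nccc_nadjP=> //.
  (* The commuting pair [y], [z ^ h] is conjugated by [g], so that its first member becomes the
     [y ^ g] that commutes with [x]. *)
  exists (h * g); rewrite ?groupM // conjgM.
  apply: (@noncentral_commute_trans _ (y ^ g)); rewrite ?noncentralJ ?groupJ //.
  exact: commute_conj_in.
by apply/idP/idP; apply: trans; [exact: sym |].
Qed.

Lemma abelian_cent_L_integral : nccc_L_integral G.
Proof.
rewrite /nccc_L_integral /nccc_L nccc_A_part nccc_D_part.
exact: multipartite_L_integral nccc_nadj_equiv.
Qed.

Lemma abelian_cent_equal_parts_integral q :
  (forall x, x \in G :\: 'Z(G) ->
     #|[set C in nccc_vertices G | ~~ nccc_adj (x ^: G) C]| = q) ->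
  [/\ nccc_integral G, nccc_L_integral G & nccc_Q_integral G].
Proof.
move=> card_part; have card_nadj i : #|[set j | nccc_nadj i j]| = q.
  have [x Zx defx] := nccc_vertP i; rewrite -(card_part x Zx) -defx.
  exact: (card_nccc_vert (fun C => ~~ nccc_adj (nccc_vert i) C)).
split.
- rewrite /nccc_integral nccc_A_part.
  exact: (regular_multipartite_integral nccc_nadj_equiv card_nadj).
- exact: abelian_cent_L_integral.
rewrite /nccc_Q_integral /nccc_Q nccc_A_part nccc_D_part.
exact: (regular_multipartite_Q_integral nccc_nadj_equiv card_nadj).
Qed.

End AbelianCentralizers.
End NonAdjacency.

(** * Groups with an abelian subgroup of index two *)

Section AbelianIndexTwo.
Set Implicit Arguments.
Unset Strict Implicit.

Variables (gT : finGroupType) (G A : {group gT}).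
Hypotheses (abA : abelian A) (sAG : A \subset G) (iAG : #|G : A| = 2).
Implicit Types x y a b z u v : gT.

Lemma index2_mulV u v : u \in G :\: A -> v \in G :\: A -> u * v^-1 \in A.
Proof. by move=> Au Av; rewrite -mem_rcoset (rcoset_index2 sAG iAG Av). Qed.

(** The centralizer of [a] contains the abelian [A] and an element of the other coset, hence all of
    [G]. *)
Lemma index2_commute_center a y :
  a \in A -> y \in G :\: A -> commute a y -> a \in 'Z(G).
Proof.
move=> Aa Ay cay; apply/centerP; split; first exact: subsetP Aa.
move=> g Gg; have [Ag | nAg] := boolP (g \in A); first exact: (centsP abA).
rewrite -(mulgKV y g); apply: commuteM => //; apply: (centsP abA) => //.
by apply: index2_mulV => //; rewrite inE nAg.
Qed.

(** If [x] is in [A], its centralizer lies in [A]. Otherwise the elements of [A] commuting with [x]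
    are central, and any other element of the centralizer is a central element times [x]. *)
Lemma index2_abelian_cent x : x \in G :\: 'Z(G) -> abelian 'C_G[x].
Proof.
case/setDP=> Gx nZx; have [Ax | nAx] := boolP (x \in A).
  apply: abelianS abA; apply/subsetP=> y /subcent1P[Gy cxy].
  apply: contraR nZx => nAy; apply: (@index2_commute_center x y) => //.
  by rewrite inE nAy.
have Gx' : x \in G :\: A by rewrite inE nAx.
have cZ u v : u \in 'C_G[x] -> v \in 'C_G[x] -> u \in A -> commute u v.
  move=> /subcent1P[Gu cxu] /subcent1P[Gv _] Au.
  have /centerP[_ Zu] := index2_commute_center Au Gx' (commute_sym cxu).
  exact: Zu.
apply/centsP=> u Cu v Cv; have [Au | nAu] := boolP (u \in A); first exact: cZ.
have /subcent1P[Gu cxu] := Cu; have /subcent1P[Gv cxv] := Cv.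
rewrite -(mulgKV x u); apply/commute_sym/commuteM; last exact: commute_sym.
apply/commute_sym/cZ => //.
  by rewrite groupM ?groupV //; apply/subcent1P.
by apply: index2_mulV => //; rewrite inE nAu.
Qed.

Lemma index2_L_integral : nccc_L_integral G.
Proof. exact: abelian_cent_L_integral index2_abelian_cent. Qed.

Section Bipartite.
Hypothesis conj_commute : {in G :\: A &, forall u v,
  exists2 g, g \in G & commute u (v ^ g)}.

(** A noncentral element of [A] commutes with nothing outside [A], so the two sides are completely
    joined; inside [A] everything commutes, and outside [A] [conj_commute] applies. *)
Lemma index2_nadj x y : x \in G :\: 'Z(G) -> y \in G :\: 'Z(G) ->
  ~~ nccc_adj (x ^: G) (y ^: G) = ((x \in A) == (y \in A)).
Proof.
case/setDP=> Gx nZx /setDP[Gy nZy].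
have nAG : G \subset 'N(A) by rewrite normal_norm ?index2_normal.
apply/nccc_nadjP/eqP=> // [[g Gg cxy] | ].
  have Ayg : (y ^ g \in A) = (y \in A) by rewrite memJ_norm ?(subsetP nAG).
  have [Ax | nAx] := boolP (x \in A); have [Ay | nAy] := boolP (y \in A) => //.
    case/negP: nZx; apply: (index2_commute_center Ax _ cxy).
    by rewrite inE Ayg nAy groupJ.
  case/negP: nZy; rewrite -(memJ_norm y (subsetP (normal_norm (center_normal G)) g Gg)).
  by apply: (@index2_commute_center _ x); rewrite ?Ayg // ?inE ?nAx //; exact: commute_sym.
have [Ax Ay | nAx nAy] := boolP (x \in A); last first.
  by apply: conj_commute; rewrite inE -?nAy ?nAx.
by exists 1; rewrite ?conjg1 //; apply: (centsP abA).
Qed.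

Lemma index2_Q_integral : nccc_Q_integral G.
Proof.
rewrite /nccc_Q_integral /nccc_Q nccc_A_part nccc_D_part.
(* As [A] is normal, a class lies wholly inside or outside it; inclusion in [A] is the
   2-colouring. *)
apply: (bipartite_Q_integral (nccc_nadj_equiv index2_abelian_cent)
          (f := fun i => nccc_vert i \subset A)) => i j.
have nAG : G \subset 'N(A) by rewrite normal_norm ?index2_normal.
rewrite /nccc_nadj; have [x Zx ->] := nccc_vertP i; have [y Zy ->] := nccc_vertP j.
by rewrite !class_sub_norm // index2_nadj.
Qed.

End Bipartite.

Section CommutatorsAndCenter.
Variable y : gT.
Hypothesis Ay : y \in G :\: A.

(** The inverse of [y] is taken because [[~ b, y^-1] * y = y ^ b]. *)
Definition comm_center_set := [set [~ b, y^-1] * z | b in A, z in 'Z(G)].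

(** On the abelian normal subgroup [A] the map sending [b] to [[~ b, y^-1]] is a homomorphism, so
    single commutators times central elements are closed under product. *)
Lemma comm_center_group_set : group_set comm_center_set.
Proof.
have Ny : y \in 'N(A).
  by case/setDP: Ay => Gy _; rewrite (subsetP (normal_norm (index2_normal sAG iAG))).
apply/group_setP; split=> [|_ _ /imset2P[b z Ab Zz ->] /imset2P[c t Ac Zt ->]].
  by apply/imset2P; exists 1 1; rewrite ?comm1g ?mulg1.
apply/imset2P; exists (b * c) (z * t); rewrite ?groupM //.
have Ak a : a \in A -> [~ a, y^-1] \in A.
  by move=> Aa; rewrite commgEl groupM ?groupV // memJ_norm ?groupV.
have /centerP[_ cz] := Zz.
have -> : [~ b * c, y^-1] = [~ b, y^-1] * [~ c, y^-1].
  by rewrite commMgJ conjgE (centsP abA _ (Ak b Ab) _ Ac) mulKg.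
have := subsetP sAG _ (Ak c Ac); move: [~ b, y^-1] [~ c, y^-1] => k l Gl.
by rewrite -!mulgA (mulgA z) (cz l Gl) -mulgA.
Qed.
Canonical comm_center_group := Group comm_center_group_set.

Lemma comm_in_comm_center b : b \in A -> [~ b, y^-1] \in comm_center_group.
Proof. by move=> Ab; apply/imset2P; exists b 1; rewrite ?mulg1. Qed.

Lemma center_sub_comm_center : 'Z(G) \subset comm_center_group.
Proof.
by apply/subsetP=> z Zz; apply/imset2P; exists 1 z; rewrite ?comm1g ?mul1g.
Qed.

(* For a in A, conjugation of a y by b in A multiplies it by [b, y^-1], so modulo
   Z(G) a single class fills A y = G :\: A. *)
Lemma comm_center_conj_commute : A \subset comm_center_set ->
  {in G :\: A &, forall u v, exists2 g, g \in G & commute u (v ^ g)}.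
Proof.
move=> sA u v Au Av; have Ac : v * y^-1 \in A by apply: index2_mulV.
have : (v * y^-1)^-1 * (u * y^-1) \in A by rewrite groupM ?groupV // index2_mulV.
case/(subsetP sA)/imset2P=> b z Ab Zz def_uv; have /centerP[Gz cz] := Zz.
exists b; first exact: subsetP Ab.
have /setDP[Gu _] := Au; have /setDP[Gy _] := Ay.
have -> : v ^ b = u * z^-1; last first.
  by apply: commuteM => //; apply/commuteV/commute_sym/cz.
have : [~ b, y^-1] * y = y ^ b by rewrite commgEl !conjgE invgK !mulgA mulgKV.
move: def_uv; move: [~ b, y^-1] => k def_uv ky; apply: (mulIg z).
rewrite mulgKV -[v](mulgKV y) -[u](mulgKV y) -[u * y^-1](mulKVg (v * y^-1)) def_uv.
by rewrite conjMg conjgE (centsP abA _ Ac _ Ab) mulKg -ky -!mulgA (cz y Gy).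
Qed.

End CommutatorsAndCenter.
End AbelianIndexTwo.

(** * Parts of equal size, and tools for index two *)

Section Cases.
Set Implicit Arguments.
Unset Strict Implicit.

Variable gT : finGroupType.
Implicit Types (G A H : {group gT}) (x y : gT).

(** [S] is the union of the classes in the part of [x]; a common class size [c] turns the size of
    [S] into a count of vertices. *)
Lemma card_nadj_part G x (S : {set gT}) c :
  G \subset 'N(S) -> S \subset G :\: 'Z(G) ->
  {in G :\: 'Z(G), forall y, ~~ nccc_adj (x ^: G) (y ^: G) = (y \in S)} ->
  {in S, forall y, #|y ^: G| = c} ->
  (#|[set C in nccc_vertices G | ~~ nccc_adj (x ^: G) C]| * c = #|S|)%N.
Proof.
move=> nSG sSG adjS cS; rewrite -(card_classes_uniform nSG cS); congr (_ * _)%N.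
apply: eq_card => C; rewrite inE; apply/andP/imsetP => [[/imsetP[y Zy ->]] | [y Sy ->]].
  by rewrite adjS // => Sy; exists y.
by have Zy := subsetP sSG y Sy; rewrite adjS //; split; first exact: imset_f.
Qed.

(** The centralizer of a noncentral [x] has index [p] and contains ['Z(G)] with index [p]. It is
    abelian and normal, and the part of [x] consists of the classes of size [p] filling its
    noncentral elements. *)
Lemma center_index_p2_integral G p :
  prime p -> #|G : 'Z(G)| = (p ^ 2)%N ->
  [/\ nccc_integral G, nccc_L_integral G & nccc_Q_integral G].
Proof.
move=> pr_p iZ; have nZG := center_normal G.
have sZC x : x \in G -> 'Z(G) \subset 'C_G[x].
  move=> Gx; apply/subsetP=> z /centerP[Gz cz].
  by apply/subcent1P; split; last exact/commute_sym/cz.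
have iC x : x \in G :\: 'Z(G) -> #|G : 'C_G[x]| = p /\ #|'C_G[x] : 'Z(G)| = p.
  case/setDP=> Gx nZx.
  have iCC : (#|G : 'C_G[x]| * #|'C_G[x] : 'Z(G)| = p * p)%N.
    by rewrite Lagrange_index ?subcent1_sub ?sZC.
  have n1 : #|'C_G[x] : 'Z(G)| != 1%N.
    by rewrite indexg_eq1; apply: contra nZx => /subsetP-> //; exact: subcent1_id.
  have n2 : #|G : 'C_G[x]| != 1%N.
    rewrite indexg_eq1; apply: contra nZx => /subsetP sGC; apply/centerP; split=> // y Gy.
    by have /subcent1P[] := sGC y Gy.
  (* The index of the centralizer divides [p ^ 2]; the exponents 0 and 2 contradict [n2] and
     [n1]. *)
  have := dvdn_mulr #|'C_G[x] : 'Z(G)| (dvdnn #|G : 'C_G[x]|).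
  rewrite iCC => /(@dvdn_pfactor p _ 2 pr_p)[[|[|[|i]]]] //= _ iG.
  - by rewrite iG in n2.
  - move/eqP: iCC; rewrite iG expn1 eqn_pmul2l ?prime_gt0 // => /eqP->.
    by split.
  move/eqP: iCC; rewrite iG -mulnn -[X in _ == X]muln1 eqn_pmul2l ?muln_gt0 ?prime_gt0 //.
  by rewrite (negPf n1).
have sCG x : 'C_G[x] \subset G by exact: subcent1_sub.
have abC : {in G :\: 'Z(G), forall x, abelian 'C_G[x]}.
  move=> x Zx; have [Gx _] := setDP Zx; have [_ iCZ] := iC x Zx.
  apply: (@cyclic_factor_abelian _ 'Z(G)).
    rewrite subsetI sZC //; apply/centsP=> z /centerP[_ cz] y /subcent1P[Gy _].
    exact: cz.
  apply: prime_cyclic; rewrite card_quotient ?iCZ //.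
  exact: subset_trans (sCG x) (normal_norm nZG).
(* [G / 'Z(G)] has order [p ^ 2], so it is abelian and the derived subgroup lies in every
   centralizer. *)
have nCG x : x \in G -> G \subset 'N('C_G[x]).
  move=> Gx; apply: sub_der1_norm (sCG x); apply: (subset_trans _ (sZC x Gx)).
  apply: der1_min (normal_norm nZG) _.
  by apply: (@card_p2group_abelian _ p) => //; rewrite card_quotient ?normal_norm.
refine (abelian_cent_equal_parts_integral abC (q := (p * #|'Z(G)| - #|'Z(G)|) %/ p) _).
move=> x Zx; have [Gx _] := setDP Zx.
have <- : #|'C_G[x] :\: 'Z(G)| = (p * #|'Z(G)| - #|'Z(G)|)%N.
  rewrite cardsD (setIidPr (sZC x Gx)) -(Lagrange (sZC x Gx)) mulnC.
  by have [_ ->] := iC x Zx.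
rewrite -(@card_nadj_part G x _ p) ?mulnK ?prime_gt0 //.
- by rewrite normsD ?nCG ?normal_norm.
- exact: setSD.
- move=> y /setDP[Gy nZy]; rewrite inE nZy; apply/nccc_nadjP/idP => // [[g Gg cxy] | ].
    by rewrite -(memJ_norm y (subsetP (nCG x Gx) g Gg)); apply/subcent1P; rewrite groupJ.
  by case/subcent1P=> _ cxy; exists 1; rewrite ?conjg1.
move=> y /setDP[/subcent1P[Gy _] nZy]; rewrite -index_cent1.
by have [|] := iC y; first by rewrite inE nZy.
Qed.

(** With [z] the order of the center, one part fills [2 * z] elements by classes of size 2, the
    other [3 * z] elements by classes of size 3: each has [z] vertices. *)
Lemma index2_card_3center_integral G A :
  abelian A -> A \subset G -> #|G : A| = 2 -> 'Z(G) \subset A -> #|A : 'Z(G)| = 3 ->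
  {in G :\: A &, forall u v, exists2 g, g \in G & commute u (v ^ g)} ->
  [/\ nccc_integral G, nccc_L_integral G & nccc_Q_integral G].
Proof.
move=> abA sAG iAG sZA iAZ conjA.
have nAG : G \subset 'N(A) by rewrite normal_norm ?index2_normal.
have cA : #|A| = (#|'Z(G)| * 3)%N by rewrite -(Lagrange sZA) iAZ.
have abC := index2_abelian_cent abA sAG iAG.
have cG : #|G| = (#|A| * 2)%N by rewrite -(Lagrange sAG) iAG.
refine (abelian_cent_equal_parts_integral abC (q := #|'Z(G)|) _) => x Zx.
have [Ax | nAx] := boolP (x \in A).
  apply/eqP; rewrite -(eqn_pmul2r (isT : 0 < 2)%N).
  rewrite (@card_nadj_part G x (A :\: 'Z(G)) 2).
  - rewrite cardsD (setIidPr sZA) cA -{2}[#|'Z(G)|]muln1 -mulnBr //.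
  - by rewrite normsD ?normal_norm ?center_normal ?index2_normal.
  - exact: setSD.
  - move=> y Zy; rewrite (index2_nadj abA sAG iAG) // Ax.
    by have [_ nZy] := setDP Zy; rewrite inE nZy eq_sym; case: (y \in A).
  (* The centralizer of a noncentral [y] in [A] is [A] itself. *)
  move=> y /setDP[Ay nZy]; rewrite -index_cent1 -iAG; congr #|_ : _|.
  apply/eqP; rewrite eqEsubset; apply/andP; split; apply/subsetP=> z.
    case/subcent1P=> Gz cyz; apply: contraR nZy => nAz.
    by apply: (index2_commute_center abA sAG iAG Ay _ cyz); rewrite inE nAz.
  move=> Az; apply/subcent1P; split; first exact: subsetP Az.
  exact: (centsP abA).
apply/eqP; rewrite -(eqn_pmul2r (isT : 0 < 3)%N).
rewrite (@card_nadj_part G x (G :\: A) 3).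
- by rewrite cardsD (setIidPr sAG) cG mulnC mul2n -addnn addnK cA.
- by rewrite normsD ?normG.
- exact: setDS.
- move=> y Zy; rewrite (index2_nadj abA sAG iAG) // (negPf nAx).
  by have [Gy _] := setDP Zy; rewrite inE Gy andbT; case: (y \in A).
(* For [y] outside [A], the centralizer meets [A] in ['Z(G)] and together with [A] fills [G], so the
   class has [#|A : 'Z(G)|] elements. *)
move=> y Gy; have /setDP[Gy' nAy] := Gy; rewrite -index_cent1.
have AC : A :&: 'C_G[y] = 'Z(G).
  apply/eqP; rewrite eqEsubset; apply/andP; split; apply/subsetP=> z.
    case/setIP=> Az /subcent1P[_ cyz].
    by apply: (index2_commute_center abA sAG iAG Az Gy); exact: commute_sym.
  move=> Zz; rewrite inE (subsetP sZA) //=; have /centerP[Gz cz] := Zz.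
  by apply/subcent1P; split=> //; exact/commute_sym/cz.
have GAC : A * 'C_G[y] = G.
  apply/eqP; rewrite eqEsubset mul_subG ?subcent1_sub //=; apply/subsetP=> g Gg.
  have [Ag | nAg] := boolP (g \in A); first by rewrite -(mulg1 g) mem_mulg.
  rewrite -(mulgKV y g) mem_mulg ?subcent1_id //.
  by apply: (index2_mulV sAG iAG _ Gy); rewrite inE nAg.
have := mul_cardG A 'C_G[y]; rewrite GAC AC -(Lagrange (subcent1_sub y G)) cA.
move=> e; apply/eqP.
rewrite -(@eqn_pmul2l (#|'C_G[y]| * #|'Z(G)|)) ?muln_gt0 ?cardG_gt0 //.
by rewrite mulnAC -e mulnC mulnA.
Qed.

Lemma cycle_extension_index2 G A y :
  y \in 'N(A) -> y ^+ 2 \in A -> A <*> <[y]> = G -> y \notin A ->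
  [/\ A \subset G, #|G : A| = 2 & y \in G :\: A].
Proof.
move=> Ny Ay2 defG nAy.
have sAG : A \subset G by rewrite -defG joing_subl.
have Gy : y \in G by rewrite -defG -cycle_subG joing_subr.
have nAG : G \subset 'N(A) by rewrite -defG join_subG normG cycle_subG.
split; rewrite ?inE ?nAy //.
rewrite -card_quotient // -defG quotientYidl ?cycle_subG // quotient_cycle // -orderE.
apply/prime_nt_dvdP => //; first by rewrite order_eq1; apply: contra nAy => /eqP/coset_idr->.
by rewrite order_dvdn -morphX //= coset_id.
Qed.

Lemma nonabelian_notin_cycle_extension G A y :
  abelian A -> A <*> <[y]> = G -> ~~ abelian G -> y \notin A.
Proof.
move=> abA defG; apply: contra => Ay; rewrite -defG.
by rewrite (joing_idPl _) ?cycle_subG.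
Qed.

(** [x] is [x ^+ m] times a power of [x ^+ 2]. In the applications the square comes from a
    commutator and the odd power from the center. *)
Lemma mem_odd_power H x m : odd m -> x ^+ 2 \in H -> x ^+ m \in H -> x \in H.
Proof.
move=> oddm Hx2 Hxm.
have defm : (2 * m./2).+1 = m by rewrite mul2n -[RHS]odd_double_half oddm.
by rewrite -(mulgK (x ^+ 2 ^+ m./2) x) -expgM -expgS defm groupM // groupV expgM groupX.
Qed.

(** Quantifying over [H] says that [A] lies in the group of commutators and central elements, and
    reduces the check to generators of [A]. *)
Lemma index2_conj_commute G A y :
  abelian A -> A \subset G -> #|G : A| = 2 -> y \in G :\: A ->
  (forall H, 'Z(G) \subset H -> {in A, forall b, [~ b, y^-1] \in H} ->
     A \subset H) ->
  {in G :\: A &, forall u v, exists2 g, g \in G & commute u (v ^ g)}.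
Proof.
move=> abA sAG iAG Gy sA; refine (comm_center_conj_commute abA sAG iAG Gy _).
apply: (sA (comm_center_group abA sAG iAG Gy)).
  exact: center_sub_comm_center.
by move=> b Ab; exact: comm_in_comm_center.
Qed.

(** * Generators and conjugation relations from the presentations *)

Lemma iso_D_gen (G : {group gT}) m : iso_D G m ->
  exists x y, [/\ <[x]> <*> <[y]> = G, x ^+ m = 1, y ^+ 2 = 1 & x ^ y^-1 = x^-1].
Proof.
case/isoGrp_hom/existsP=> -[x y] /= /eqP[defG xm y2 xy]; exists x, y.
by split=> //; rewrite conjgE invgK mulgA.
Qed.

Lemma iso_T_gen (G : {group gT}) m : iso_T G m ->
  exists x y, [/\ <[x]> <*> <[y]> = G, x ^+ m = y ^+ 2 & x ^ y = x^-1].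
Proof.
case/isoGrp_hom/existsP=> -[x y] /= /eqP[defG _ xm xy]; exists x, y.
by split=> //; rewrite conjgE mulgA.
Qed.

Lemma iso_SD_gen (G : {group gT}) m : iso_SD G m ->
  exists x y, [/\ <[x]> <*> <[y]> = G, x ^+ (4 * m) = 1, y ^+ 2 = 1
    & x ^ y^-1 = x ^+ (2 * m - 1)].
Proof.
case/isoGrp_hom/existsP=> -[x y] /= /eqP[defG xm y2 xy]; exists x, y.
split=> //; rewrite conjgE invgK mulgA -xy; congr (_ * _).
by apply: (mulgI y); rewrite mulgV.
Qed.

Lemma iso_U_gen (G : {group gT}) n m : iso_U G n m ->
  exists x y, [/\ <[x]> <*> <[y]> = G, y ^+ m = 1 & y ^ x = y^-1].
Proof.
case/isoGrp_hom/existsP=> -[x y] /= /eqP[defG xm y2 xy]; exists x, y.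
by split=> //; rewrite conjgE mulgA.
Qed.

Lemma iso_V_gen (G : {group gT}) m : iso_V G m ->
  exists x y, [/\ <[x]> <*> <[y]> = G, commute x (y ^+ 2)
    & x ^ y^-1 = x^-1 * y ^- 2].
Proof.
case/isoGrp_hom/existsP=> -[x y] /= /eqP[defG _ y4 yx y'x]; exists x, y.
have conjx : x ^ y^-1 = x^-1 * y ^- 2.
  by rewrite conjgE invgK mulgA yx -mulgA expg2 invMg.
split=> //; have conjx' : x ^ y = x^-1 * y ^+ 2.
  by rewrite conjgE mulgA y'x -mulgA.
have zy : (y ^+ 2) ^ y = y ^+ 2 by rewrite conjgE -expgSr expgS mulKg.
have z2 : y ^+ 2 * y ^+ 2 = 1 by rewrite -expgD.
(* With [z = y ^+ 2], conjugating the formula for [x ^ y^-1] by [y] gives [x = z^-1 * x * z^-1];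
   since [z] is an involution or trivial, [x] and [z] commute. *)
have := conjgKV y x; move: (y ^+ 2) zy z2 conjx conjx' => z zy z2 -> conjx'.
rewrite conjMg !conjVg conjx' zy invMg invgK => defx.
have zV : z^-1 = z by apply: (mulIg z); rewrite mulVg.
by rewrite /commute -{1}defx zV -mulgA z2 mulg1.
Qed.

(* Groups given by two generators *)
End Cases.

Section Generators.
Set Implicit Arguments.
Unset Strict Implicit.

Variables (gT : finGroupType) (G : {group gT}) (x y : gT).
Hypothesis defG : <[x]> <*> <[y]> = G.

Lemma center_gens z : z \in G -> commute x z -> commute y z -> z \in 'Z(G).
Proof.
move=> Gz cxz cyz; rewrite inE Gz -sub_cent1 -defG join_subG !cycle_subG.
by rewrite !(introT cent1P).
Qed.

Lemma nonabelian_gens : ~~ abelian G -> ~ commute x y.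
Proof.
by move=> /negP nabG cxy; apply: nabG; rewrite -defG abelianY !cycle_abelian cent_cycle cycle_subG; apply/cent1P/commute_sym.
Qed.

Lemma cycle_index2 : ~~ abelian G -> y ^+ 2 \in <[x]> -> x ^ y \in <[x]> ->
  [/\ <[x]> \subset G, #|G : <[x]>| = 2 & y \in G :\: <[x]>].
Proof.
move=> nabG y2 xy; apply: cycle_extension_index2 => //.
  by rewrite -cycle_subG norms_cycle.
exact: nonabelian_notin_cycle_extension (cycle_abelian x) defG nabG.
Qed.

Lemma conjV_mem_cycle : x ^ y^-1 \in <[x]> -> x ^ y \in <[x]>.
Proof. by rewrite -!norms_cycle !cycle_subG groupV. Qed.

(** For odd [m] take [k = m], where the power is trivial. Otherwise take [k = m %/ 2]: the power
    equals its own inverse, so [y] fixes it. *)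
Lemma inverted_odd_power_center m :
  odd m \/ ~~ odd m /\ odd (m %/ 2) -> x ^+ m = 1 -> x ^ y = x^-1 ->
  exists2 k, odd k & x ^+ k \in 'Z(G).
Proof.
have Gx : x \in G by rewrite -defG -cycle_subG joing_subl.
move=> [oddm | [evenm oddm2]] xm xy; first by exists m; rewrite // xm group1.
exists (m %/ 2) => //; apply: center_gens; first exact: groupX.
  exact/commuteX/commute_refl.
have xx : (x ^+ (m %/ 2)) ^ y = x ^+ (m %/ 2).
  rewrite conjXg xy expgVn; apply: (mulgI (x ^+ (m %/ 2))).
  by rewrite mulgV -expgD addnn divn2 even_halfK.
exact/commute_sym/commgP/conjg_fixP.
Qed.

End Generators.

(** * The groups [U_{(n,m)}] and [U_{6m}] *)

Section UGroups.
Set Implicit Arguments.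
Unset Strict Implicit.

Variables (gT : finGroupType) (G : {group gT}) (x y : gT).
Hypotheses (defG : <[x]> <*> <[y]> = G) (yx : y ^ x = y^-1) (nabG : ~~ abelian G).

(** Here [x] is the outer element: it inverts [y], so [x ^+ 2] is central. *)
Let A := (<[x ^+ 2]> <*> <[y]>)%G.

Lemma U_square_commute : commute y (x ^+ 2).
Proof. by apply/commgP/conjg_fixP; rewrite expg2 conjgM yx conjVg yx invgK. Qed.

Lemma U_square_center : x ^+ 2 \in 'Z(G).
Proof.
apply: (center_gens defG); last exact: U_square_commute.
  by rewrite groupX // -defG -cycle_subG joing_subl.
exact/commuteX/commute_refl.
Qed.

Lemma U_abelian : abelian A.
Proof.
rewrite abelianY !cycle_abelian cent_cycle cycle_subG.
exact/cent1P/U_square_commute.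
Qed.

Lemma U_index2 : [/\ A \subset G, #|G : A| = 2 & x \in G :\: A].
Proof.
have Ax2 : x ^+ 2 \in A by rewrite -cycle_subG joing_subl.
have AxG : A <*> <[x]> = G.
  rewrite /= -defG joingC joingA; congr (_ <*> _).
  by apply/joing_idPl; rewrite cycleX.
apply: cycle_extension_index2 => //.
  rewrite -cycle_subG normsY // norms_cycle.
    by rewrite conjgE -expgSr expgS mulKg cycle_id.
  by rewrite yx groupV cycle_id.
exact: nonabelian_notin_cycle_extension U_abelian AxG nabG.
Qed.

Lemma U_L_integral : nccc_L_integral G.
Proof. by have [sAG iAG _] := U_index2; exact: index2_L_integral U_abelian sAG iAG. Qed.

Lemma U_conj_commute m : odd m \/ ~~ odd m /\ odd (m %/ 2) -> y ^+ m = 1 ->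
  {in G :\: A &, forall u v, exists2 g, g \in G & commute u (v ^ g)}.
Proof.
move=> oddm ym; have [sAG iAG Gx] := U_index2.
have [k oddk Zyk] : exists2 k, odd k & y ^+ k \in 'Z(G).
  by apply: inverted_odd_power_center oddm ym yx; rewrite joingC.
(* Using [x^-1] as outer element turns the commutator into [[~ y, x]], which is the inverse of
   [y ^+ 2]. *)
have Gx' : x^-1 \in G :\: A by rewrite inE !groupV -in_setD.
apply: (index2_conj_commute U_abelian sAG iAG Gx') => H sZH sKH.
rewrite join_subG !cycle_subG (subsetP sZH) ?U_square_center //=.
apply: (mem_odd_power oddk); last exact: (subsetP sZH).
have : [~ y, x^-1^-1] \in H by apply: sKH; rewrite -cycle_subG joing_subr.
by rewrite invgK commgEl yx -invMg groupV.
Qed.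

Lemma U_Q_integral m : odd m \/ ~~ odd m /\ odd (m %/ 2) -> y ^+ m = 1 ->
  nccc_Q_integral G.
Proof.
move=> oddm ym; have [sAG iAG _] := U_index2.
exact: index2_Q_integral U_abelian sAG iAG (U_conj_commute oddm ym).
Qed.

(** [A] is the product of ['Z(G)] and the subgroup of order 3 generated by [y], which meet
    trivially. *)
Lemma U6_integral : y ^+ 3 = 1 ->
  [/\ nccc_integral G, nccc_L_integral G & nccc_Q_integral G].
Proof.
move=> y3; have [sAG iAG Gx] := U_index2.
have nZy : y \notin 'Z(G).
  apply/negP=> /centerP[_ cy]; apply: (nonabelian_gens defG nabG).
  by apply/commute_sym/cy; have /setDP[] := Gx.
have oy : #[y] = 3.
  by apply: nt_prime_order => //; apply: contraNneq nZy => ->; exact: group1.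
(* A central element outside [A] would commute with [y] and force [y] to be central. *)
have sZA : 'Z(G) \subset A.
  apply/subsetP=> z /centerP[Gz cz]; apply: contraR nZy => nAz.
  apply: (index2_commute_center U_abelian sAG iAG _ _ (commute_sym (cz y _))).
  - by rewrite -cycle_subG joing_subr.
  - by rewrite inE nAz.
  by rewrite -defG -cycle_subG joing_subr.
refine (index2_card_3center_integral U_abelian sAG iAG sZA _ _); last first.
  by apply: (@U_conj_commute 3) => //; left.
have defA : 'Z(G) * <[y]> = A.
  rewrite -norm_joinEr; last first.
    by rewrite cycle_subG (subsetP (normal_norm (center_normal G))) // -defG -cycle_subG joing_subr.
  apply/eqP; rewrite eqEsubset !join_subG sZA joing_subr joing_subr.
  by rewrite (subset_trans _ (joing_subl _ _)) // cycle_subG U_square_center.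
have tiZy : 'Z(G) :&: <[y]> = 1 by rewrite setIC prime_TIg ?cycle_subG // -orderE oy.
rewrite -divgS // -[#|A|]/#|(A : {set gT})| -defA TI_cardMg // -orderE oy.
by rewrite mulKn ?cardG_gt0.
Qed.

End UGroups.

(** * Integrality for each family *)

Section Integrality.
Set Implicit Arguments.
Unset Strict Implicit.

Variables (gT : finGroupType) (G : {group gT}).
Hypothesis nabG : ~~ abelian G.

Lemma cycle_gens_L_integral x y : <[x]> <*> <[y]> = G ->
  y ^+ 2 \in <[x]> -> x ^ y \in <[x]> -> nccc_L_integral G.
Proof.
move=> defG y2 xy; have [sxG iG _] := cycle_index2 defG nabG y2 xy.
exact: index2_L_integral (cycle_abelian x) sxG iG.
Qed.

Lemma cycle_gens_Q_integral x y : <[x]> <*> <[y]> = G ->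
  y ^+ 2 \in <[x]> -> x ^ y^-1 \in <[x]> ->
  (forall H : {group gT}, 'Z(G) \subset H -> [~ x, y^-1] \in H -> x \in H) ->
  nccc_Q_integral G.
Proof.
move=> defG y2 xy Hx; have [sxG iG Gy] := cycle_index2 defG nabG y2 (conjV_mem_cycle xy).
apply: (index2_Q_integral (cycle_abelian x) sxG iG).
apply: (index2_conj_commute (cycle_abelian x) sxG iG Gy) => H sZH sKH.
by rewrite cycle_subG Hx // sKH ?cycle_id.
Qed.

Lemma D_Q_integral m : odd m \/ ~~ odd m /\ odd (m %/ 2) -> iso_D G m ->
  nccc_Q_integral G.
Proof.
move=> oddm /iso_D_gen[x [y [defG xm y2 xy]]].
apply: (cycle_gens_Q_integral defG); rewrite ?y2 ?xy ?groupV ?cycle_id ?group1 //.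
move=> H sZH; rewrite commgEl xy -invMg groupV => Hx2.
have [|k oddk Zxk] := inverted_odd_power_center _ oddm xm xy (G := G).
  by rewrite cycleV.
exact: mem_odd_power oddk Hx2 (subsetP sZH _ Zxk).
Qed.

(** The odd power [x ^+ m] equals [y ^+ 2], hence is central. *)
Lemma T_Q_integral m : odd m -> iso_T G m -> nccc_Q_integral G.
Proof.
move=> oddm /iso_T_gen[x [y [defG xm xy]]].
have {}xy : x ^ y^-1 = x^-1 by rewrite -[x in LHS]invgK -xy -conjVg conjgK.
apply: (cycle_gens_Q_integral defG); rewrite -?xm ?xy ?groupV ?mem_cycle ?cycle_id //.
move=> H sZH; rewrite commgEl xy -invMg groupV => Hx2.
apply: (mem_odd_power oddm Hx2); apply: (subsetP sZH); apply: (center_gens defG).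
- by rewrite groupX // -defG -cycle_subG joing_subl.
- exact/commuteX/commute_refl.
by rewrite xm; exact/commuteX/commute_refl.
Qed.

Lemma SD_Q_integral m : odd m -> iso_SD G m -> nccc_Q_integral G.
Proof.
move=> oddm /iso_SD_gen[x [y [defG xm y2 xy]]].
have m_gt0 : (0 < m)%N by case: m oddm {xm xy}.
have Gx : x \in G by rewrite -defG -cycle_subG joing_subl.
apply: (cycle_gens_Q_integral defG); rewrite ?y2 ?xy ?mem_cycle ?group1 //.
have {}xy : x ^ y^-1 = x^-1 * x ^+ (2 * m).
  by rewrite xy -[in RHS](@subnK 1 (2 * m)) ?muln_gt0 // addn1 expgS mulKg.
move=> H sZH; rewrite commgEl xy => Hx.
have Hxm : x ^+ m \in H.
  apply: (subsetP sZH); apply: (center_gens defG); first exact: groupX.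
    exact/commuteX/commute_refl.
  apply/commute_sym/commgP/conjg_fixP; apply: (canLR (conjgKV y)).
  rewrite conjXg xy expgMn; last exact/commuteX/commute_sym/commuteV/commute_refl.
  (* For odd [m], [2 * m * m] is congruent to [2 * m] modulo [4 * m], so [y^-1] fixes [x ^+ m],
     which is therefore central. *)
  have e : (2 * m * m = 2 * m + 4 * m * m./2)%N.
    rewrite -[X in (2 * m * X)%N](odd_double_half m) oddm -mul2n mulnDr muln1.
    by rewrite mulnA (mulnAC 2 m 2).
  rewrite -expgM e expgD (expgM x (4 * m)) xm expg1n mulg1.
  by rewrite mul2n -addnn expgD expgVn mulKg.
apply: (mem_odd_power oddm _ Hxm).
move: Hx; rewrite mulgA groupMr; last by rewrite mulnC expgM groupX.
by rewrite -invMg groupV.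
Qed.

(** Since [y ^+ 2] commutes with [x], the two generate an abelian subgroup, normalized by [y] and of
    index two. *)
Lemma V_L_integral m : iso_V G m -> nccc_L_integral G.
Proof.
case/iso_V_gen=> x [y [defG cxy xy]].
pose A := (<[x]> <*> <[y ^+ 2]>)%G.
have abA : abelian A.
  by rewrite abelianY !cycle_abelian cent_cycle cycle_subG; apply/cent1P/commute_sym.
have AyG : A <*> <[y]> = G.
  by rewrite /= -defG -joingA; congr (_ <*> _); apply/joing_idPr; rewrite cycleX.
have [sAG iAG _] : [/\ A \subset G, #|G : A| = 2 & y \in G :\: A].
  apply: cycle_extension_index2 => //; last exact: nonabelian_notin_cycle_extension AyG nabG.
    rewrite -groupV inE /= -genJ gen_subG conjUg subUset -!cycleJ !cycle_subG.
    rewrite xy conjgE invgK mulgA -expgS (expgSr y 2) mulgK groupM ?groupV.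
    - by rewrite -cycle_subG joing_subr.
    - by rewrite -cycle_subG joing_subl.
    by rewrite -cycle_subG joing_subr.
  by rewrite -cycle_subG joing_subr.
exact: index2_L_integral abA sAG iAG.
Qed.

(** The preimage of the rotations has index two, and is abelian because it is cyclic modulo a
    central subgroup. *)
Lemma central_dihedral_L_integral m : iso_D (G / 'Z(G)) m -> nccc_L_integral G.
Proof.
case/(@iso_D_gen _ (G / 'Z(G))%G)=> x [y [defG _ y2 xy]].
have nZG := normal_norm (center_normal G).
have nab_ext (K : {group gT}) : 'Z(G) \subset 'Z(K) -> cyclic (K / 'Z(G)) -> abelian K.
  exact: cyclic_factor_abelian.
(* Otherwise [G / 'Z(G)] would be cyclic and [G] abelian. *)
have ny : y \notin <[x]>.
  apply: contra nabG => xy'; apply: nab_ext => //; rewrite -[_ / _]defG.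
  by rewrite (joing_idPl _) ?cycle_subG ?cycle_cyclic.
have [||sxG iG _] := cycle_extension_index2 _ _ defG ny.
- by rewrite -cycle_subG norms_cycle conjV_mem_cycle // xy groupV cycle_id.
- by rewrite y2 group1.
pose A := (coset 'Z(G) @*^-1 <[x]>)%G.
have sZA : 'Z(G) \subset A by exact: sub_cosetpre.
have sAG : A \subset G by rewrite -(quotientGK (center_normal G)) morphpreS.
apply: (@index2_L_integral _ G A) => //; last first.
  have <- : #|G / 'Z(G) : A / 'Z(G)| = #|G : A|.
    by apply: index_quotient_eq => //; apply: subset_trans (subsetIr _ _) sZA.
  by rewrite cosetpreK.
apply: nab_ext; last by rewrite cosetpreK cycle_cyclic.
rewrite subsetI sZA (subset_trans (subsetIr _ _)) // centS //.
Qed.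

End Integrality.

Theorem theorem3p2 (gT : finGroupType) (G : {group gT}) :
  ~~ abelian G ->
  [/\
   (* (1) *)
   ((exists p : nat, prime p /\ G / 'Z(G) \isog [set: 'Z_p * 'Z_p])
    \/ (exists m : nat, (2 <= m)%N /\ iso_U6 G m)) ->
     [/\ nccc_integral G, nccc_L_integral G & nccc_Q_integral G],
   (* (2) *)
   ((exists m : nat, (3 <= m)%N /\ iso_D G m)
    \/ (exists m : nat, (2 <= m)%N /\ iso_T G m)
    \/ (exists m : nat, (2 <= m)%N /\ iso_SD G m)
    \/ (exists n m : nat, (3 <= m)%N /\ (2 <= n)%N /\ iso_U G n m)
    \/ (exists m : nat, (2 <= m)%N /\ iso_V G m)
    \/ (exists m : nat, (3 <= m)%N /\ iso_D (G / 'Z(G)) m)) ->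
     nccc_L_integral G,
   (* (3) *)
   (forall m : nat, (3 <= m)%N -> odd m ->
      iso_D G m \/ iso_T G m \/ iso_SD G m \/
      (exists n : nat, (2 <= n)%N /\ iso_U G n m) ->
      nccc_Q_integral G)
 & (* (4) *)
   (forall m : nat, ~~ odd m -> odd (m %/ 2) ->
      iso_D G m \/ (exists n : nat, (2 <= n)%N /\ iso_U G n m) ->
      nccc_Q_integral G)].
Proof.
move=> nabG; split.
(* [U_{6m}] is [U_{(m,3)}] by conversion. *)
- case=> [[p [pr_p isoZ]] | [m [_ /(@iso_U_gen _ _ _ 3)[x [y [defG y3 yx]]]]]].
    apply: (center_index_p2_integral pr_p).
    rewrite -card_quotient ?normal_norm ?center_normal // (card_isog isoZ).
    by rewrite cardsT card_prod card_ord Zp_cast ?prime_gt1.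
  exact: U6_integral defG yx nabG y3.
- case=> [[m [_ /iso_D_gen[x [y [defG _ y2 xy]]]]] |].
    apply: (cycle_gens_L_integral nabG defG); first by rewrite y2 group1.
    by rewrite conjV_mem_cycle // xy groupV cycle_id.
  case=> [[m [_ /iso_T_gen[x [y [defG xm xy]]]]] |].
    apply: (cycle_gens_L_integral nabG defG); first by rewrite -xm mem_cycle.
    by rewrite xy groupV cycle_id.
  case=> [[m [_ /iso_SD_gen[x [y [defG _ y2 xy]]]]] |].
    apply: (cycle_gens_L_integral nabG defG); first by rewrite y2 group1.
    by rewrite conjV_mem_cycle // xy mem_cycle.
  case=> [[n [m [_ [_ /iso_U_gen[x [y [defG _ yx]]]]]]] |].
    exact: U_L_integral defG yx nabG.
  case=> [[m [_ isoV]] | [m [_ isoD]]]; first exact (V_L_integral nabG isoV).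
  exact (central_dihedral_L_integral nabG isoD).
- move=> m _ oddm [isoD | [isoT | [isoSD | [n [_ isoU]]]]].
  + exact (D_Q_integral nabG (or_introl oddm) isoD).
  + exact (T_Q_integral nabG oddm isoT).
  + exact (SD_Q_integral nabG oddm isoSD).
  have [x [y [defG ym yx]]] := iso_U_gen isoU.
  exact (U_Q_integral defG yx nabG (or_introl oddm) ym).
move=> m evenm oddm2 [isoD | [n [_ isoU]]].
  exact (D_Q_integral nabG (or_intror (conj evenm oddm2)) isoD).
have [x [y [defG ym yx]]] := iso_U_gen isoU.
exact (U_Q_integral defG yx nabG (or_intror (conj evenm oddm2)) ym).
Qed.
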